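(* Let $B=B(F)$ be the one-sided stationary generalized Bratteli diagram given by the $\mathbb N\times\mathbb N$ incidence matrix $F=(f_{ij})$ with $f_{i,i}=i+1$, $f_{i,i+1}=1$ for all $i\in\mathbb N=\{1,2,\dots\}$, and all other entries zero, i.e. $$F=\begin{pmatrix}2&1&0&0&\ldots\\0&3&1&0&\ldots\\0&0&4&1&\ldots\\0&0&0&5&\ldots\\\vdots&\vdots&\vdots&\vdots&\ddots\end{pmatrix}.$$ Then there does not exist any non-zero tail-invariant measure on $X_B$ that assigns finite values to cylinder sets.
   Context: The stationary generalized Bratteli diagram $B(F)$ has vertex levels $V_n=\mathbb N$, $n\ge0$, and for every $n\ge0$ exactly $f_{v,w}$ edges from $w\in V_n$ to $v\in V_{n+1}$; $s,r$ denote source and range of an edge. The path space $X_B$ is the set of infinite paths $x=(x_i)_{i\ge0}$, where $x_i$ is an edge from $V_i$ to $V_{i+1}$ and $r(x_i)=s(x_{i+1})$, with the topology generated by the cylinder sets $[\overline e]=\{x: x_0=e_0,\dots,x_n=e_n\}$ of finite paths $\overline e=(e_0,\dots,e_n)$ starting at $V_0$. A (positive, Borel, non-atomic) measure $\mu$ on $X_B$ is tail-invariant if $\mu([\overline e])=\mu([\overline e'])$ for any two cylinder sets given by finite paths $\overline e,\overline e'$ from $V_0$ with $r(\overline e)=r(\overline e')$. *)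

(* Defs.v *)
From HB Require Import structures.
From mathcomp Require Import all_boot all_order all_algebra.
From mathcomp Require Import all_classical all_reals all_analysis.

Set Implicit Arguments.
Unset Strict Implicit.
Unset Printing Implicit Defensive.

Local Open Scope classical_set_scope.
Local Open Scope ring_scope.
Local Open Scope ereal_scope.

(* The index set {1, 2, ...} of every level. *)
Definition vertex := {i : nat | (0 < i)%N}.

Definition vertex1 : vertex := exist _ 1%N isT.

(* F v w is the number of edges from w in V_n to v in V_{n+1}. *)
Definition incidence := vertex -> vertex -> nat.

Section StationaryDiagram.
Variable F : incidence.

(* By stationarity a single type serves as the set of edges from V_n to V_{n+1}
   for all n; the tag of an edge is the pair (source, range). *)
Definition edge := {wv : vertex * vertex & 'I_(F wv.2 wv.1)}.

Definition edge_source (e : edge) : vertex := (tag e).1.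
Definition edge_range (e : edge) : vertex := (tag e).2.

Definition path_space :=
  {x : nat -> edge | forall i, edge_range (x i) = edge_source (x i.+1)}.

HB.instance Definition _ := gen_eqMixin path_space.
HB.instance Definition _ := gen_choiceMixin path_space.

(* The finite paths (e_0, ..., e_n), which start at V_0 and end at V_{n+1}. *)
Definition finite_path n :=
  {e : n.+1.-tuple edge | sorted (fun a b => edge_range a == edge_source b) e}.

(* The range of a finite path as a vertex of V_{n+1}: the levels are disjoint
   copies of the index set, so only finite paths with the same n may have the
   same range. *)
Definition path_range n (e : finite_path n) : vertex :=
  edge_range (tnth (val e) ord_max).

Definition cylinder n (e : finite_path n) : set path_space :=
  [set x : path_space | forall i : 'I_n.+1, sval x (val i) = tnth (val e) i].

Definition cylinders : set (set path_space) :=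
  [set C | exists n (e : finite_path n), C = cylinder e].

HB.instance Definition _ :=
  @isSubBaseTopological.Build path_space _ cylinders id.

End StationaryDiagram.

Definition triF : incidence := fun i j =>
  if val j == val i then (val i).+1
  else if val j == (val i).+1 then 1%N else 0%N.

Definition X_B := path_space triF.

HB.instance Definition _ := Topological.on X_B.

(* Measurable types are required to be pointed: the base point is a path that
   stays at the vertex 1. *)
Definition loop1 : edge triF :=
  existT (fun wv => 'I_(triF wv.2 wv.1)) (vertex1, vertex1) ord0.

Definition path1 : X_B :=
  exist (fun x => forall i, edge_range (x i) = edge_source (x i.+1))
    (fun=> loop1) (fun=> erefl).

HB.instance Definition _ := isPointed.Build X_B path1.

Definition borel_X_B := g_sigma_algebraType (@open X_B).

Section Measures.
Variables (R : realType) (mu : {measure set borel_X_B -> \bar R}).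

Definition atom (A : set borel_X_B) :=
  [/\ measurable A, 0 < mu A &
    forall B, measurable B -> B `<=` A -> mu B = 0 \/ mu (A `\` B) = 0].

Definition non_atomic := forall A, ~ atom A.

Definition tail_invariant :=
  non_atomic /\
  forall n (e e' : finite_path triF n),
    path_range e = path_range e' -> mu (cylinder e) = mu (cylinder e').

Definition finite_on_cylinders :=
  forall n (e : finite_path triF n), mu (cylinder e) < +oo.

Definition nonzero := exists2 A, measurable A & mu A != 0.

End Measures.

(* Main.v *)
Require Import Defs.
From mathcomp Require Import all_boot all_order all_algebra.
From mathcomp Require Import all_classical all_reals all_analysis.

Set Implicit Arguments.
Unset Strict Implicit.
Unset Printing Implicit Defensive.

(** By tail invariance a measure finite on cylinders is encoded by reals
    p_n(v) >= 0: the mass of any cylinder whose finite path has n.+1 edges and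
    ends at the vertex v.  Splitting a cylinder according to the next edge
    ([measure_cylinder_split]) gives p_n(w) = sum_v f_{v,w} p_{n+1}(v), which
    for the triangular matrix reads
      p_n(1) = 2 p_{n+1}(1),
      p_n(i+1) = (i+2) p_{n+1}(i+1) + p_{n+1}(i).
    Suppose that p vanishes at the vertices below i.  Then p_n(i) is a constant
    c times (i+1)^-n.  The vertex i+1 has at least as many loops, so
    (i+1)^n p_n(i+1) decreases with n, and the term p_{n+1}(i) makes it drop
    by at least c / (i+1) at every step.  As it stays nonnegative, c = 0
    ([forcing_eq0]).  By induction on i all cylinders are null
    ([triangular_recurrence_eq0]), and the whole space is the union of the
    countably many cylinders given by a single edge ([measure_eq0_of_edges]). *)

Import Order.TTheory GRing.Theory Num.Theory.

Local Open Scope classical_set_scope.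
Local Open Scope ring_scope.

(** * Nonnegative recurrences *)

Section Growth.
Variable R : archiRealFieldType.

Lemma natmul_bounded_eq0 (x c : R) :
  0 <= x -> (forall N : nat, x *+ N <= c) -> x = 0.
Proof.
move=> x0 xc; apply/eqP; apply: contraT => xneq0.
have xgt0 : 0 < x by rewrite lt_def xneq0.
have /archi_boundP : 0 <= c / x by rewrite divr_ge0 // (xc 0%N).
by rewrite ltr_pdivrMr // mulr_natl ltNge xc.
Qed.

(** The sequence [b] is geometric of ratio 1/k, while [c] decays at least as fast
    and also pays [b n.+1] at step n.  Iterating, the rescaled total payment after
    N steps is N equal amounts, whence N b_n <= k c_n for all N. *)
Lemma forcing_eq0 (k : nat) (b c : nat -> R) :
  (forall n, 0 <= b n) -> (forall n, 0 <= c n) ->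
  (forall n, b n = b n.+1 *+ k) ->
  (forall n, b n.+1 + c n.+1 *+ k <= c n) ->
  forall n, b n = 0.
Proof.
move=> b0 c0 bE cE n; apply: (@natmul_bounded_eq0 _ (c n *+ k)) => // N.
(* The bound N b_m <= k c_m is inductive when stated for all m: applied at
   n.+1 it turns the hypothesis on [c] into (N + 1) b_(n+1) <= c_n. *)
elim: N n => [|N IHN] n; first by rewrite mulr0n mulrn_wge0.
rewrite bE -mulrnA mulnC mulrnA lerMn2r; apply/orP; right.
by apply: le_trans (cE n); rewrite mulrS lerD2l.
Qed.

(** The index i stands for the vertex i+1, hence the i+2 loops there.  The layers
    vanish one after the other, but layer i is killed by layer i+1: it would
    force the latter to become negative. *)
Lemma triangular_recurrence_eq0 (a : nat -> nat -> R) :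
  (forall i n, 0 <= a i n) ->
  (forall n, a 0 n = a 0 n.+1 *+ 2) ->
  (forall i n, a i.+1 n = a i n.+1 + a i.+1 n.+1 *+ i.+3) ->
  forall i n, a i n = 0.
Proof.
move=> a0 aE0 aES.
have next i : (forall n, a i n = a i n.+1 *+ i.+2) -> forall n, a i n = 0.
  move=> aE; apply: (@forcing_eq0 i.+2 (a i) (a i.+1)) => // n.
  by rewrite (aES i n) lerD2l ler_wpMn2l.
elim=> [|i IHi]; first exact: next.
by apply: next => n; rewrite aES IHi add0r.
Qed.

End Growth.

(** * Finite paths *)

Section FinitePaths.
Variable F : incidence.


Lemma path_rcons_subproof n (e : finite_path F n) (f : edge F) :
  path_range e = edge_source f ->
  sorted (fun a b => edge_range a == edge_source b)
         [tuple of rcons (val e) f].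
Proof.
case: e => -[[//|a s] /= ss] es; rewrite /path_range /= (tnth_nth a) /= => h.
rewrite rcons_path es /= -h -(succn_inj (eqP ss)).
by rewrite -[X in nth _ _ X]/(size (a :: s)).-1 nth_last.
Qed.

Definition path_rcons n (e : finite_path F n) (f : edge F)
    (ef : path_range e = edge_source f) : finite_path F n.+1 :=
  exist _ [tuple of rcons (val e) f] (path_rcons_subproof ef).

Lemma path_range_rcons n (e : finite_path F n) (f : edge F)
    (ef : path_range e = edge_source f) :
  path_range (path_rcons ef) = edge_range f.
Proof.
by rewrite /path_range (tnth_nth f) /= nth_rcons size_tuple ltnn eqxx.
Qed.

Lemma cylinder_rcons n (e : finite_path F n) (f : edge F)
    (ef : path_range e = edge_source f) :
  cylinder (path_rcons ef) =
  cylinder e `&` [set x | sval x n.+1 = f].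
Proof.
apply/seteqP; split=> x /=.
  move=> xe; split.
    move=> i; have := xe (widen_ord (leqnSn _) i).
    by rewrite !(tnth_nth f) /= nth_rcons size_tuple ltn_ord.
  by have := xe ord_max; rewrite (tnth_nth f) /= nth_rcons size_tuple ltnn eqxx.
move=> [xe xf] i; rewrite (tnth_nth f) /= nth_rcons size_tuple.
case: (ltngtP i n.+1) => [lt_in|gt_in|->]; last exact: xf.
  by have := xe (Ordinal lt_in); rewrite (tnth_nth f).
by move: (ltn_ord i); rewrite ltnS leqNgt gt_in.
Qed.

Lemma cylinder_range n (e : finite_path F n) x :
  cylinder e x -> edge_source (sval x n.+1) = path_range e.
Proof. by move=> xe; rewrite -(svalP x n) /path_range -(xe ord_max). Qed.

Definition edge_path (f : edge F) : finite_path F 0 :=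
  exist _ [tuple f] isT.

Lemma open_cylinder n (e : finite_path F n) : open (cylinder e).
Proof.
exists [set cylinder e]; last by rewrite bigcup_set1.
by move=> _ ->; apply: finI_from1; exists n, e.
Qed.

Lemma constant_path_subproof (f : edge F) n :
  edge_range f = edge_source f ->
  sorted (fun a b => edge_range a == edge_source b) [tuple of nseq n.+1 f].
Proof. by move=> fE /=; elim: n => //= n ->; rewrite fE eqxx. Qed.

(** These are all the edges out of [w] when [s] contains every vertex they can
    reach ([mem_out_edges]). *)
Definition out_edges (w : vertex) (s : seq vertex) : seq (edge F) :=
  [seq existT (fun wv : vertex * vertex => 'I_(F wv.2 wv.1)) (w, v) k
     | v <- s, k <- enum 'I_(F v w)].

Lemma out_edges_uniq w s : uniq s -> uniq (out_edges w s).
Proof.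
move=> us; apply: allpairs_uniq_dep => // [v _|]; first exact: enum_uniq.
move=> [v k] [v' k'] _ _ /= /eqP.
rewrite -tag_eqE /tag_eq /= => /andP[/eqP[vv']].
by subst v'; rewrite tagged_asE => /eqP ->.
Qed.

Lemma mem_out_edges w s f :
  (forall v, F v w != 0%N -> v \in s) ->
  (f \in out_edges w s) = (edge_source f == w).
Proof.
move=> sF; apply/idP/eqP; first by case/allpairsPdep => v [k [_ _ ->]].
case: f => -[w' v] k; rewrite /edge_source /= => ww'; subst w'.
apply/allpairsPdep; exists v, k; split=> //; last by rewrite mem_enum.
by apply: sF; case: (F v w) k => [[]|].
Qed.

End FinitePaths.

(** * Measures determined by the ranges of finite paths *)

Section Mass.
Variables (R : realType) (mu : {measure set borel_X_B -> \bar R}).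

Lemma measurable_cylinder n (e : finite_path triF n) :
  measurable (cylinder e : set borel_X_B).
Proof. by apply: sub_sigma_algebra; exact: open_cylinder. Qed.

(** The cylinder is the disjoint union of its extensions by one edge, and the
    [triF v w] extensions that end at [v] have equal mass. *)
Lemma measure_cylinder_split n (e : finite_path triF n) (s : seq vertex)
    (p : vertex -> R) :
  uniq s -> (forall v, triF v (path_range e) != 0%N -> v \in s) ->
  (forall e' : finite_path triF n.+1,
    mu (cylinder e') = (p (path_range e'))%:E) ->
  mu (cylinder e) =
  (\sum_(v <- s) p v *+ triF v (path_range e))%:E.
Proof.
move=> us sF pE; set w := path_range e; set o := out_edges triF w s.
pose C f : set borel_X_B :=
  cylinder e `&` [set x : X_B | sval x n.+1 = f].
have CE f : f \in o ->
    measurable (C f) /\ mu (C f) = (p (edge_range f))%:E.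
  rewrite mem_out_edges // => /eqP/esym ef.
  rewrite /C -(cylinder_rcons ef) pE path_range_rcons.
  by split=> //; exact: measurable_cylinder.
have -> : cylinder e = \bigcup_(f in [set` o]) C f.
  apply/seteqP; split=> [x xe|x [f _ []//]].
  exists (sval x n.+1) => //=.
  by rewrite mem_out_edges // (cylinder_range xe).
rewrite measure_fin_bigcup; [| exact: finite_seq | | by move=> f /CE[]]; last first.
  by move=> f g _ _ [x [[_ <-] [_ <-]]].
rewrite -fsbig_seq ?out_edges_uniq //.
rewrite (eq_big_seq (fun f => (p (edge_range f))%:E)); last first.
  by move=> f /CE[].
rewrite sumEFin /o big_allpairs_dep; congr _%:E; apply: eq_bigr => v _.
by rewrite big_enum /edge_range /= sumr_const card_ord.
Qed.

Lemma measure_eq0_of_edges :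
  (forall e : finite_path triF 0, mu (cylinder e) = 0%E) ->
  forall A, measurable A -> mu A = 0%E.
Proof.
move=> mu0 A mA; apply: measure_negligible => //.
pose C k : set borel_X_B := if unpickle k is Some f
  then cylinder (edge_path f) else set0.
apply: (@negligibleS _ _ _ _ (\bigcup_k C k)).
  move=> x _; exists (pickle (sval x 0%N)) => //.
  by rewrite /C pickleK => i; rewrite (ord1 i).
apply: negligible_bigcup => k; rewrite /C; case: unpickle => [f|].
  by apply/negligibleP; [exact: measurable_cylinder|exact: mu0].
exact: negligible_set0.
Qed.

End Mass.

(** * The triangular diagram *)

Definition vertexS (i : nat) : vertex := exist _ i.+1 isT.

Lemma vertexS_pred (v : vertex) : vertexS (val v).-1 = v.
Proof. by apply: val_inj => /=; case: v => -[]. Qed.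

Lemma triF_diag (v : vertex) : triF v v = (val v).+1.
Proof. by rewrite /triF eqxx. Qed.

Lemma triF_down i : triF (vertexS i) (vertexS i.+1) = 1%N.
Proof. by rewrite /triF /= (gtn_eqF (ltnSn _)) eqxx. Qed.

Lemma triF_neq0 u v : triF u v != 0%N -> val v = val u \/ val v = (val u).+1.
Proof.
rewrite /triF; case: (val v =P val u) => [|_]; first by left.
by case: (val v =P (val u).+1) => // vu _; right.
Qed.

(** Loops provide, at every level, a finite path that ends at a given vertex. *)
Definition loop (v : vertex) : edge triF :=
  existT (fun wv => 'I_(triF wv.2 wv.1)) (v, v)
    (cast_ord (esym (triF_diag v)) ord0).

Definition loops (v : vertex) n : finite_path triF n :=
  exist _ [tuple of nseq n.+1 (loop v)]
    (@constant_path_subproof triF (loop v) n erefl).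

Lemma path_range_loops v n : path_range (loops v n) = v.
Proof.
rewrite /path_range (tnth_nth (loop v)).
rewrite -[LHS]/(edge_range (nth (loop v) (nseq n.+1 (loop v)) n)).
by rewrite nth_nseq ltnSn.
Qed.

Theorem proposition6p11 (R : realType) :
  ~ exists mu : {measure set borel_X_B -> \bar R},
      [/\ tail_invariant mu, finite_on_cylinders mu & nonzero mu].
Proof.
move=> [mu [[_ muT] muF [A mA /eqP muA]]]; apply: muA.
pose p n v := fine (mu (cylinder (loops v n))).
have pE n (e : finite_path triF n) :
    mu (cylinder e) = (p n (path_range e))%:E.
  rewrite /p fineK ?ge0_fin_numE ?muF //.
  by apply: muT; rewrite path_range_loops.
have p_rec n v s : uniq s -> (forall u, triF u v != 0%N -> u \in s) ->
    p n v = \sum_(u <- s) p n.+1 u *+ triF u v.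
  move=> us sF; apply: EFin_inj.
  by rewrite -{1}(path_range_loops v n) -pE
    (@measure_cylinder_split _ _ _ _ s (p n.+1)) ?path_range_loops.
(* The vertex [vertexS i] is i+1, so the rows of the recurrence start at i = 0. *)
suff p0 i n : p n (vertexS i) = 0.
  apply: (@measure_eq0_of_edges _ mu) => // e.
  by rewrite pE -(vertexS_pred (path_range e)) p0.
apply: (@triangular_recurrence_eq0 _ (fun i n => p n (vertexS i))).
- by move=> j m; rewrite fine_ge0.
- move=> m; rewrite (@p_rec m _ [:: vertexS 0]) ?big_seq1 ?triF_diag //.
  move=> u /triF_neq0; rewrite inE -val_eqE /=.
  by case: u => -[//|u] _ /= [[<-]|].
- move=> j m; rewrite (@p_rec m _ [:: vertexS j; vertexS j.+1]) //.
  + by rewrite big_cons big_seq1 triF_diag triF_down.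
  + by rewrite /= inE -val_eqE /= (ltn_eqF (ltnSn _)).
  + move=> u /triF_neq0; rewrite !inE -!val_eqE /=.
    by move=> [->|[->]]; rewrite eqxx ?orbT.
Qed.
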